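(* Let $\mathbb G_1,\mathbb G_2$ be compact quantum groups. Assume that $\mathbf E\subset \mathrm{Irr}(\mathbb G_1)$ and $\mathbf F\subset \mathrm{Irr}(\mathbb G_2)$ are Sidon sets. Then $\mathbf E \cup \mathbf F$ is a Sidon set for the dual free product $\mathbb G_1 \hat{*}\,\mathbb G_2$.
   Context: For a compact quantum group $\mathbb G$ (Woronowicz) with Haar state $h$, $\mathrm{Irr}(\mathbb G)$ is the set of classes of irreducible unitary representations with fixed representatives $u^{(\pi)}=[u^{(\pi)}_{ij}]\in C(\mathbb G)\otimes B(H_\pi)$; $\mathrm{Pol}(\mathbb G)$ is the span of the $u^{(\pi)}_{ij}$, $\mathrm{Pol}_{\mathbf E}(\mathbb G)=\mathrm{span}\{u_{ij}^{(\pi)}:\pi\in\mathbf E\}$; $C_r(\mathbb G)$ is the C*-algebra generated by $\mathrm{Pol}(\mathbb G)$ in the GNS representation of $h$, with norm $\|\cdot\|_\infty$. $Q_\pi\in B(H_\pi)$ is the unique positive invertible operator with $d_\pi:=\mathrm{Tr}(Q_\pi)=\mathrm{Tr}(Q_\pi^{-1})$ and $h((u_{ij}^{(\pi)})^*u_{lm}^{(\pi)})=\delta_{jm}(Q_\pi^{-1})_{li}/d_\pi$. For $x\in\mathrm{Pol}(\mathbb G)$, $\hat x(\pi)=(h(\cdot\,x)\otimes\iota)((u^{(\pi)})^* )$ and $\|\hat x\|_1=\sum_\pi d_\pi\mathrm{Tr}(|\hat x(\pi)Q_\pi|)$. $\mathbf E\subset\mathrm{Irr}(\mathbb G)$ is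 a Sidon set if there is $K>0$ with $\|\hat x\|_1\le K\|x\|_\infty$ for all $x\in\mathrm{Pol}_{\mathbf E}(\mathbb G)$. The dual free product $\mathbb G_1\hat*\,\mathbb G_2$ (S. Wang) is the compact quantum group whose reduced algebra $C_r(\mathbb G_1\hat*\,\mathbb G_2)$ is the reduced free product of $C_r(\mathbb G_1)$ and $C_r(\mathbb G_2)$ with respect to their Haar states, with comultiplication extending those of $\mathbb G_1,\mathbb G_2$; its Haar state is the free product state. Irreducible representations of $\mathbb G_1$ and $\mathbb G_2$ are viewed as irreducible representations of $\mathbb G_1\hat*\,\mathbb G_2$ through the canonical embeddings. *)

(* Defs.v *)
From HB Require Import structures.
From mathcomp Require Import all_boot all_order all_algebra.
From mathcomp Require Import complex.
From mathcomp Require Import all_classical all_reals all_analysis.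

Set Implicit Arguments.
Unset Strict Implicit.
Unset Printing Implicit Defensive.

Import Order.TTheory GRing.Theory Num.Theory.

Local Open Scope classical_set_scope.
Local Open Scope ring_scope.
Local Open Scope complex_scope.
Local Open Scope sesquilinear_scope.

(* The complex norm [`|c|] of R[i] is R[i]-valued; C*-norms are R-valued.
   [Num.conj] is complex conjugation. *)
HB.mixin Record Algebra_isCstar (R : realType) A of GRing.Algebra R[i] A := {
  star : A -> A;
  cnorm : A -> R;
  starD : forall x y, star (x + y) = star x + star y;
  starZ : forall (c : R[i]) x, star (c *: x) = Num.conj c *: star x;
  starM : forall x y, star (x * y) = star y * star x;
  starK : forall x, star (star x) = x;
  cnormD : forall x y, cnorm (x + y) <= cnorm x + cnorm y;
  cnormZ : forall (c : R[i]) x, cnorm (c *: x) = complex.Re `|c| * cnorm x;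
  cnorm0_eq0 : forall x, cnorm x = 0 -> x = 0;
  cnormM : forall x y, cnorm (x * y) <= cnorm x * cnorm y;
  cnorm_star_mul : forall x, cnorm (star x * x) = cnorm x ^+ 2;
  cnorm_complete : forall u : nat -> A,
    (forall e : R, 0 < e ->
       exists N, forall m n, (N <= m)%N -> (N <= n)%N -> cnorm (u m - u n) < e) ->
    exists l, forall e : R, 0 < e ->
       exists N, forall n, (N <= n)%N -> cnorm (u n - l) < e
}.

#[short(type="cstarAlgType")]
HB.structure Definition CstarAlgebra (R : realType) :=
  { A of GRing.Algebra R[i] A & Algebra_isCstar R A }.

Definition linear_map (R : realType) (A B : lmodType R[i]) (f : A -> B) : Prop :=
  forall (c : R[i]) x y, f (c *: x + y) = c *: f x + f y.

Definition unital_star_hom (R : realType) (A B : cstarAlgType R) (f : A -> B)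
    : Prop :=
  [/\ linear_map f, forall x y, f (x * y) = f x * f y, f 1 = 1
    & forall x, f (star x) = star (f x)].

Definition bounded_map (R : realType) (A B : cstarAlgType R) (f : A -> B)
    : Prop :=
  exists M : R, forall x, cnorm (f x) <= M * cnorm x.

Definition state (R : realType) (A : cstarAlgType R) (h : A -> R[i]) : Prop :=
  [/\ forall (c : R[i]) x y, h (c *: x + y) = c * h x + h y,
      forall x, 0 <= h (star x * x), h 1 = 1
    & forall x, complex.Re `|h x| <= cnorm x].

Definition cclosure (R : realType) (A : cstarAlgType R) (S : set A) : set A :=
  [set x | forall e : R, 0 < e -> exists2 y, S y & cnorm (x - y) < e].

Definition lspan (R : realType) (V : lmodType R[i]) (S : set V) : set V :=
  [set x | exists n (c : 'I_n -> R[i]) (v : 'I_n -> V),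
     (forall k, S (v k)) /\ x = \sum_(k < n) c k *: v k].

Definition star_subalgebra (R : realType) (A : cstarAlgType R) (S : set A)
    : Prop :=
  [/\ S 1, forall (c : R[i]) x y, S x -> S y -> S (c *: x + y),
      forall x y, S x -> S y -> S (x * y)
    & forall x, S x -> S (star x)].

(* [gns_norm h x] is the operator norm of x in the GNS representation of h,
   i.e. the supremum of ||x y||_h over ||y||_h <= 1, ||y||_h^2 = h(y^* y). *)
Definition gns_norm (R : realType) (A : cstarAlgType R) (h : A -> R[i]) (x : A)
    : \bar R :=
  ereal_sup [set (Num.sqrt (complex.Re (h (star (x * y) * (x * y)))))%:E
            | y in [set y : A | h (star y * y) <= 1]].

(* T is the completion of the algebraic tensor product of A and B for some
   C*-norm, [t a b] being the elementary tensor.  The fifth clause says that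
   the algebraic tensor product embeds in T. *)
Record cstar_tensor (R : realType) (A B T : cstarAlgType R) (t : A -> B -> T)
    : Prop := {
  ct_linl : forall b, linear_map (fun a => t a b);
  ct_linr : forall a, linear_map (fun b => t a b);
  ct_mul : forall a a' b b', t a b * t a' b' = t (a * a') (b * b');
  ct_one : t 1 1 = 1;
  ct_star : forall a b, star (t a b) = t (star a) (star b);
  ct_inj : forall n (a : 'I_n -> A) (b : 'I_n -> B),
    (forall c : 'I_n -> R[i], \sum_(k < n) c k *: b k = 0 ->
       forall k, c k = 0) ->
    \sum_(k < n) t (a k) (b k) = 0 -> forall k, a k = 0;
  ct_dense : cclosure (lspan [set t ab.1 ab.2 | ab in [set: A * B]]) = setT
}.

(* The minimal tensor product: the completion for the least C*-norm. *)
Definition min_tensor (R : realType) (A B T : cstarAlgType R) (t : A -> B -> T)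
    : Prop :=
  cstar_tensor t /\
  forall (T' : cstarAlgType R) (t' : A -> B -> T'), cstar_tensor t' ->
  forall n (a : 'I_n -> A) (b : 'I_n -> B),
    cnorm (\sum_(k < n) t (a k) (b k)) <= cnorm (\sum_(k < n) t' (a k) (b k)).

(* [cqg_A] is C(G), [cqg_AA] its minimal tensor square and [cqg_AAA] its
   minimal tensor cube, identified with both A (x) (A (x) A) and
   (A (x) A) (x) A.  The maps [cqg_Di] and [cqg_iD] are Delta (x) id and
   id (x) Delta; the last two fields are the cancellation (density) laws. *)
Record cqg (R : realType) := CQG {
  cqg_A : cstarAlgType R;
  cqg_AA : cstarAlgType R;
  cqg_AAA : cstarAlgType R;
  tens : cqg_A -> cqg_A -> cqg_AA;
  tensl : cqg_AA -> cqg_A -> cqg_AAA;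
  tensr : cqg_A -> cqg_AA -> cqg_AAA;
  tens_min : min_tensor tens;
  tensl_min : min_tensor tensl;
  tensr_min : min_tensor tensr;
  tensA : forall a b c, tensl (tens a b) c = tensr a (tens b c);
  Delta : cqg_A -> cqg_AA;
  Delta_hom : unital_star_hom Delta;
  cqg_Di : cqg_AA -> cqg_AAA;
  cqg_iD : cqg_AA -> cqg_AAA;
  cqg_Di_hom : unital_star_hom cqg_Di;
  cqg_iD_hom : unital_star_hom cqg_iD;
  cqg_DiE : forall a b, cqg_Di (tens a b) = tensl (Delta a) b;
  cqg_iDE : forall a b, cqg_iD (tens a b) = tensr a (Delta b);
  coassoc : forall x, cqg_Di (Delta x) = cqg_iD (Delta x);
  cancell : cclosure (lspan [set Delta ab.1 * tens ab.2 1
                            | ab in [set: cqg_A * cqg_A]]) = setT;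
  cancelr : cclosure (lspan [set Delta ab.1 * tens 1 ab.2
                            | ab in [set: cqg_A * cqg_A]]) = setT
}.

(* [Sl] and [Sr] are the slice maps h (x) id and id (x) h. *)
Definition haar_state (R : realType) (G : cqg R) (h : cqg_A G -> R[i]) : Prop :=
  state h /\
  exists Sl Sr : cqg_AA G -> cqg_A G,
    [/\ linear_map Sl /\ bounded_map Sl, linear_map Sr /\ bounded_map Sr,
        forall a b, Sl (tens a b) = h a *: b,
        forall a b, Sr (tens a b) = h b *: a
      & forall x, Sl (Delta x) = (h x)%:A /\ Sr (Delta x) = (h x)%:A].

Section Representations.
Variables (R : realType) (G : cqg R).

Definition amp_mx m n (X : 'M[R[i]]_(m, n)) : 'M[cqg_A G]_(m, n) :=
  map_mx (fun c : R[i] => c%:A) X.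

Definition adj_mx m n (u : 'M[cqg_A G]_(m, n)) : 'M[cqg_A G]_(n, m) :=
  map_mx star u^T.

Definition unitary_rep n (u : 'M[cqg_A G]_n) : Prop :=
  [/\ u *m adj_mx u = 1%:M, adj_mx u *m u = 1%:M
    & forall i j, Delta (u i j) = \sum_k tens (u i k) (u k j)].

Definition intertwiner m n (u : 'M[cqg_A G]_m) (v : 'M[cqg_A G]_n)
    (X : 'M[R[i]]_(n, m)) : Prop :=
  amp_mx X *m u = v *m amp_mx X.

Definition irreducible_rep n (u : 'M[cqg_A G]_n) : Prop :=
  (0 < n)%N /\ forall X : 'M[R[i]]_n, intertwiner u u X -> exists c, X = c%:M.

Definition equiv_rep m n (u : 'M[cqg_A G]_m) (v : 'M[cqg_A G]_n) : Prop :=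
  exists (X : 'M[R[i]]_(n, m)) (Y : 'M[R[i]]_(m, n)),
    [/\ intertwiner u v X, X *m Y = 1%:M & Y *m X = 1%:M].

End Representations.

Definition psdmx (R : realType) n (P : 'M[R[i]]_n) : Prop :=
  P ^t* = P /\ forall v : 'rV[R[i]]_n, 0 <= (v *m P *m v ^t*) 0 0.

(* The unique positive square root of A^* A. *)
Definition absmx (R : realType) n (A : 'M[R[i]]_n) : 'M[R[i]]_n :=
  xget 0 [set P | psdmx P /\ P *m P = A ^t* *m A].

Definition trace_norm (R : realType) n (A : 'M[R[i]]_n) : R :=
  complex.Re (\tr (absmx A)).

(* Q is the operator Q_pi of the irreducible unitary representation u; the
   trace normalization makes it unique. *)
Definition modular_mx (R : realType) (G : cqg R) (h : cqg_A G -> R[i]) n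
    (u : 'M[cqg_A G]_n) (Q : 'M[R[i]]_n) : Prop :=
  [/\ psdmx Q, Q \in unitmx, \tr Q = \tr (invmx Q)
    & forall i j l m, h (star (u i j) * u l m) =
        (j == m)%:R * invmx Q l i / \tr Q].

(* A set of indices for Irr(G), with a fixed representative of each class
   and its matrix Q_pi. *)
Record irreps (R : realType) (G : cqg R) (h : cqg_A G -> R[i]) := Irreps {
  irr_index :> choiceType;
  irr_dim : irr_index -> nat;
  irr_rep : forall p : irr_index, 'M[cqg_A G]_(irr_dim p);
  irr_Q : forall p : irr_index, 'M[R[i]]_(irr_dim p);
  irr_unitary : forall p, unitary_rep (irr_rep p);
  irr_irreducible : forall p, irreducible_rep (irr_rep p);
  irr_distinct : forall p q, equiv_rep (irr_rep p) (irr_rep q) -> p = q;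
  irr_complete : forall n (u : 'M[cqg_A G]_n),
    unitary_rep u -> irreducible_rep u -> exists p, equiv_rep u (irr_rep p);
  irr_modular : forall p, modular_mx h (irr_rep p) (irr_Q p)
}.

Section Sidon.
Variables (R : realType) (G : cqg R) (h : cqg_A G -> R[i]) (I : irreps h).

Definition Pol_on (E : set I) : set (cqg_A G) :=
  lspan [set x | exists2 p, E p & exists i j, x = irr_rep p i j].

Definition fourier (x : cqg_A G) (p : I) : 'M[R[i]]_(irr_dim p) :=
  \matrix_(i, j) h (adj_mx (irr_rep p) i j * x).

Definition fourier_norm1 (x : cqg_A G) : \bar R :=
  \esum_(p in [set: I])
    (complex.Re (\tr (irr_Q p)) * trace_norm (fourier x p *m irr_Q p))%:E.

Definition Sidon (E : set I) : Prop :=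
  exists2 K : R, 0 < K & forall x, Pol_on E x ->
    (fourier_norm1 x <= K%:E * gns_norm h x)%E.

End Sidon.

(* Freeness of two subalgebras: h vanishes on nonempty alternating words in
   centered elements; the boolean tells which subalgebra a letter is from. *)
Definition free_pair (R : realType) (A : cstarAlgType R) (h : A -> R[i])
    (B1 B2 : set A) : Prop :=
  forall w : seq (bool * A),
    w != [::] -> sorted (fun p q => p.1 != q.1) w ->
    (forall p, p \in w -> (if p.1 then B1 else B2) p.2 /\ h p.2 = 0) ->
    h (\prod_(p <- w) p.2) = 0.

(* A unital *-homomorphism j : A1 -> A with ||j x|| equal to the norm of x in
   the GNS representation of h1 is the same as a unital isometric
   *-homomorphism from pi_{h1}(A1), the reduced algebra of (A1, h1), to A. *)
Definition reduced_embedding (R : realType) (A1 A : cstarAlgType R)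
    (h1 : A1 -> R[i]) (j : A1 -> A) : Prop :=
  unital_star_hom j /\ forall x, (cnorm (j x))%:E = gns_norm h1 x.

(* (A, h) is the reduced free product of the GNS images of (A1, h1) and
   (A2, h2), in Voiculescu's characterization. *)
Record reduced_free_product (R : realType) (A1 A2 A : cstarAlgType R)
    (h1 : A1 -> R[i]) (h2 : A2 -> R[i]) (h : A -> R[i])
    (j1 : A1 -> A) (j2 : A2 -> A) : Prop := {
  rfp_emb1 : reduced_embedding h1 j1;
  rfp_emb2 : reduced_embedding h2 j2;
  rfp_state1 : forall x, h (j1 x) = h1 x;
  rfp_state2 : forall x, h (j2 x) = h2 x;
  rfp_free : free_pair h (range j1) (range j2);
  rfp_generated : forall S : set A, star_subalgebra S -> cclosure S `<=` S ->
    range j1 `<=` S -> range j2 `<=` S -> S = setT;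
  rfp_gns_faithful : forall x, gns_norm h x = 0%E -> x = 0
}.

(* [jj] is j (x) j; the comultiplication of G restricts to that of G1. *)
Definition comult_extends (R : realType) (G1 G : cqg R)
    (j : cqg_A G1 -> cqg_A G) : Prop :=
  exists jj : cqg_AA G1 -> cqg_AA G,
    [/\ unital_star_hom jj, forall a b, jj (tens a b) = tens (j a) (j b)
      & forall x, Delta (j x) = jj (Delta x)].

(* G, taken in its reduced form C(G) = C_r(G), is the dual free product of G1
   and G2, with canonical maps j1 and j2. *)
Definition dual_free_product (R : realType) (G1 G2 G : cqg R)
    (h1 : cqg_A G1 -> R[i]) (h2 : cqg_A G2 -> R[i]) (h : cqg_A G -> R[i])
    (j1 : cqg_A G1 -> cqg_A G) (j2 : cqg_A G2 -> cqg_A G) : Prop :=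
  [/\ reduced_free_product h1 h2 h j1 j2, comult_extends j1
    & comult_extends j2].

(* The classes of Irr(G) containing the image under j of some u^(p), p in E. *)
Definition irr_image (R : realType) (G1 G : cqg R)
    (h1 : cqg_A G1 -> R[i]) (h : cqg_A G -> R[i])
    (I1 : irreps h1) (I : irreps h) (j : cqg_A G1 -> cqg_A G) (E : set I1)
    : set I :=
  [set q | exists2 p, E p & equiv_rep (map_mx j (irr_rep p)) (irr_rep q)].

Arguments Sidon {R G h} I E.
Arguments irr_image {R G1 G h1 h I1} I j E.

(* Main.v *)
Require Import Defs.
From mathcomp Require Import all_boot all_order all_algebra.
From mathcomp Require Import complex ring.
From mathcomp Require Import all_classical all_reals all_analysis.

(** Up to a scalar c, an x in the span of the coefficients of E and F is
    j1 y + j2 z with y, z in the spans of E and F and centered, because the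
    coefficients of an irreducible representation either have Haar mean zero or
    are scalars.  Test x on vectors j1 a of the GNS space: by freeness
    j1 ((y + c) a) and j2 z * j1 a are orthogonal, so ||(y + c) a|| <= ||x j1 a||,
    whence |c| <= ||x|| and ||y|| <= 2 ||x||, and likewise for z.  On the Fourier
    side, x^ is supported on E and F by Schur orthogonality, and at a nontrivial
    q of E it is unitarily conjugate to y^, since freeness kills the
    contribution of z.  Hence ||x^||_1 is at most ||y^||_1 + ||z^||_1 plus the
    term of the trivial representation, a multiple of |c|. *)

Set Implicit Arguments.
Unset Strict Implicit.
Unset Printing Implicit Defensive.

Import Order.TTheory GRing.Theory Num.Theory.

Local Open Scope classical_set_scope.
Local Open Scope ring_scope.
Local Open Scope complex_scope.
Local Open Scope sesquilinear_scope.

(** * Positive matrices, square roots and the trace norm *)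

Section PositiveMatrices.
Variable R : realType.
Implicit Types m n : nat.
Local Notation C := R[i].

Lemma adjmxM m n p (A : 'M[C]_(m, n)) (B : 'M[C]_(n, p)) :
  (A *m B) ^t* = B ^t* *m A ^t*.
Proof. by rewrite trmx_mul map_mxM. Qed.

Lemma adjmxB m n (A B : 'M[C]_(m, n)) : (A - B) ^t* = A ^t* - B ^t*.
Proof. by apply/matrixP=> i j; rewrite !mxE rmorphB. Qed.

Lemma adjmxZ m n (a : C) (A : 'M[C]_(m, n)) : (a *: A) ^t* = Num.conj a *: A ^t*.
Proof. by apply/matrixP=> i j; rewrite !mxE rmorphM. Qed.

Lemma mulmx_adj_diagE m n (A : 'M[C]_(m, n)) i :
  (A *m A ^t*) i i = \sum_j `|A i j| ^+ 2.
Proof. by rewrite !mxE; apply: eq_bigr => j _; rewrite !mxE -normCK. Qed.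

Lemma mulmx_adj_eq0 m n (A : 'M[C]_(m, n)) : A *m A ^t* = 0 -> A = 0.
Proof.
move=> A0; apply/matrixP=> i j; rewrite mxE; apply/eqP.
have /eqP : \sum_j `|A i j| ^+ 2 = 0 by rewrite -mulmx_adj_diagE A0 mxE.
rewrite psumr_eq0; last by move=> k _; rewrite exprn_ge0.
by move=> /allP/(_ j (mem_index_enum _)) /=; rewrite sqrf_eq0 normr_eq0.
Qed.

Lemma psdmx_conj m n (U : 'M[C]_(m, n)) (P : 'M[C]_n) :
  psdmx P -> psdmx (U *m P *m U ^t*).
Proof.
move=> [Ph Pp]; split; first by rewrite !adjmxM trmxCK Ph mulmxA.
by move=> v; move: (Pp (v *m U)); rewrite adjmxM !mulmxA.
Qed.

Lemma psdmx_diag_ge0 n (P : 'M[C]_n) i : psdmx P -> 0 <= P i i.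
Proof.
move=> [_ Pp]; move: (Pp (delta_mx 0 i)); rewrite -rowE mxE.
rewrite (bigD1 i) //= big1 ?addr0 ?mxE.
  by rewrite !eqxx /= rmorph1 mulr1.
by move=> j /negbTE ji; rewrite !mxE ji andbF rmorph0 mulr0.
Qed.

Lemma psdmx0 n : psdmx (0 : 'M[C]_n).
Proof.
split; first by rewrite trmx0 map_mx0.
by move=> v; rewrite mulmx0 mul0mx mxE.
Qed.

Lemma psdmx_trace_ge0 n (P : 'M[C]_n) : psdmx P -> 0 <= \tr P.
Proof. by move=> Pp; apply: sumr_ge0 => i _; exact: psdmx_diag_ge0. Qed.

Lemma psdmxZ n (a : C) (P : 'M[C]_n) : 0 <= a -> psdmx P -> psdmx (a *: P).
Proof.
move=> a0 [Ph Pp]; split; first by rewrite adjmxZ Ph (CrealP (ger0_real a0)).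
by move=> v; rewrite -scalemxAr -scalemxAl mxE mulr_ge0.
Qed.

(* Otherwise the form would be negative at v - t (v P) for small t > 0. *)
Lemma psdmx_isotropic n (P : 'M[C]_n) (v : 'rV[C]_n) :
  psdmx P -> (v *m P *m v ^t*) 0 0 = 0 -> v *m P = 0.
Proof.
move=> [Ph Pp] v0; apply: mulmx_adj_eq0.
set w := v *m P.
have wE : (w *m w ^t*) 0 0 = \sum_j `|w 0 j| ^+ 2 by exact: mulmx_adj_diagE.
set a := (w *m w ^t*) 0 0 in wE.
set b := (w *m P *m w ^t*) 0 0.
have a0 : 0 <= a by rewrite wE sumr_ge0 // => j _; rewrite exprn_ge0.
have b0 : 0 <= b := Pp w.
have key t : 0 <= t -> 0 <= t ^+ 2 * b - t * a *+ 2.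
  move=> t0; have := Pp (v - t *: w).
  rewrite adjmxB adjmxZ (CrealP (ger0_real t0)) !mulmxBl mulmxBr -/w.
  have wPv : w *m P *m v ^t* = w *m w ^t* by rewrite /w adjmxM Ph mulmxA.
  rewrite -!mulmxA !mulmxBr -!scalemxAr -!scalemxAl !mulmxA wPv -/w.
  have expand (X Y Z : 'M[C]_1) : (X - t *: Y - (t *: Y - t *: (t *: Z))) 0 0 =
      X 0 0 + (t ^+ 2 * Z 0 0 - t * Y 0 0 *+ 2).
    by rewrite !mxE mulr2n expr2; ring.
  by rewrite expand v0 add0r.
apply/matrixP=> i j; rewrite !ord1 -/a mxE; apply/eqP.
have [//|an0] := eqVneq a 0.
have {}a0 : 0 < a by rewrite lt_def an0.
have c0 : 0 < a + b by rewrite ltr_pwDl.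
(* The value a/(a+b) of t makes sense also for b = 0, and turns t^2 b - 2ta into the negative number
   -t^2 (2a + b). *)
have := key (a / (a + b)) (divr_ge0 (ltW a0) (ltW c0)).
have -> : (a / (a + b)) ^+ 2 * b - a / (a + b) * a *+ 2 =
  - ((a / (a + b)) ^+ 2 * (a + a + b)).
  by field; rewrite lt0r_neq0.
have pos : 0 < (a / (a + b)) ^+ 2 * (a + a + b).
  by rewrite mulr_gt0 ?exprn_gt0 ?divr_gt0 // -addrA addr_gt0.
by rewrite oppr_ge0 => /(lt_le_trans pos); rewrite ltxx.
Qed.

(** With D = P - Q, equality of the squares gives DP + QD = 0. So the traces of DPD and DQD, both
    nonnegative, add up to 0 and vanish; applied to the rows of D, isotropy yields DP = DQ = 0,
    hence D^2 = 0 with D self-adjoint. *)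
Lemma psdmx_sqrt_unique n (P Q : 'M[C]_n) :
  psdmx P -> psdmx Q -> P *m P = Q *m Q -> P = Q.
Proof.
move=> Pp Qp PQ; pose D := P - Q.
have Dh : D ^t* = D by rewrite adjmxB Pp.1 Qp.1.
have DD : D *m P + Q *m D = 0.
  by rewrite /D mulmxBl mulmxBr PQ addrA subrK subrr.
have : \tr (D *m P *m D ^t*) + \tr (D *m Q *m D ^t*) = 0.
  rewrite Dh (mxtrace_mulC (D *m P)) -[D *m Q *m D]mulmxA -mxtraceD.
  by rewrite -mulmxDr DD mulmx0 mxtrace0.
have trP S : psdmx S -> \tr (D *m S *m D ^t*) = 0 -> D *m S = 0.
  move=> Sp /eqP; rewrite psumr_eq0; last first.
    by move=> i _; apply: psdmx_diag_ge0; exact: psdmx_conj.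
  move=> /allP S0; apply/row_matrixP => i; rewrite row0 row_mul.
  apply: psdmx_isotropic => //.
  have /eqP <- := S0 i (mem_index_enum _).
  have -> : (row i D) ^t* = col i (D ^t*) by apply/matrixP=> a b; rewrite !mxE.
  by rewrite -row_mul !mxE; apply: eq_bigr => k _; rewrite !mxE.
move/eqP; rewrite paddr_eq0 ?psdmx_trace_ge0 //; try exact: psdmx_conj.
move=> /andP[/eqP/(trP _ Pp) DP /eqP/(trP _ Qp) DQ].
have D0 : D = 0 by apply: mulmx_adj_eq0; rewrite Dh {2}/D mulmxBr DP DQ subr0.
by apply/eqP; rewrite -subr_eq0 -/D D0.
Qed.

Lemma absmxE n (A P : 'M[C]_n) :
  psdmx P -> P *m P = A ^t* *m A -> absmx A = P.
Proof.
move=> Pp PA; rewrite /absmx; case: xgetP => [Q _ [Qp QA]|/(_ P)[]//].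
by apply: psdmx_sqrt_unique => //; rewrite QA.
Qed.

(** Separates the true square root from the default 0 of [xget]; the facts on [absmx] below are
    proved on both branches, without the spectral theorem. *)
Lemma absmx_id n (A : 'M[C]_n) :
  (psdmx (absmx A) /\ absmx A *m absmx A = A ^t* *m A) \/
  absmx A = 0 /\ forall P, psdmx P -> P *m P <> A ^t* *m A.
Proof.
rewrite /absmx; case: xgetP => [Q _ [Qp QA]|nA]; first by left.
by right; split=> // P Pp PA; exact: (nA P).
Qed.

Lemma trace_norm_ge0 n (A : 'M[C]_n) : 0 <= trace_norm A.
Proof.
rewrite /trace_norm; case: (absmx_id A) => [[Pp _]|[-> _]].
  by have := psdmx_trace_ge0 Pp; rewrite lecE => /andP[].
by rewrite mxtrace0.
Qed.

(* [absmx] falls back on the junk value 0 when there is no square root, so that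
   invariance has to be proved in both directions. *)
Lemma absmx_unitary m n (U : 'M[C]_(m, n)) (A : 'M[C]_n) :
  U *m U ^t* = 1%:M -> U ^t* *m U = 1%:M ->
  absmx (U *m A *m U ^t*) = U *m absmx A *m U ^t*.
Proof.
move=> UU UU'.
have sqE (P B : 'M[C]_n) : P *m P = B ->
    U *m P *m U ^t* *m (U *m P *m U ^t*) = U *m B *m U ^t*.
  by move=> <-; rewrite !mulmxA -[_ *m U ^t* *m U]mulmxA UU' mulmx1.
have AE : (U *m A *m U ^t*) ^t* *m (U *m A *m U ^t*) =
    U *m (A ^t* *m A) *m U ^t*.
  by rewrite !adjmxM trmxCK !mulmxA -[_ *m U ^t* *m U]mulmxA UU' mulmx1.
case: (absmx_id A) => [[Pp PA]|[-> noA]].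
  apply: absmxE; first exact: psdmx_conj.
  by rewrite AE; exact: sqE.
rewrite mulmx0 mul0mx; case: (absmx_id (U *m A *m U ^t*)) => [[]|[]//].
set P := absmx _ => Pp; rewrite AE => PE; exfalso.
apply: (noA (U ^t* *m P *m U)).
  by rewrite -{2}(trmxCK U); exact: psdmx_conj.
rewrite !mulmxA -[_ *m U *m U ^t*]mulmxA UU mulmx1 -[_ *m P *m P]mulmxA PE.
by rewrite !mulmxA UU' mul1mx -[_ *m U ^t* *m U]mulmxA UU' mulmx1.
Qed.

Lemma trace_norm_unitary m n (U : 'M[C]_(m, n)) (A : 'M[C]_n) :
  U *m U ^t* = 1%:M -> U ^t* *m U = 1%:M ->
  trace_norm (U *m A *m U ^t*) = trace_norm A.
Proof.
move=> UU UU'; rewrite /trace_norm absmx_unitary // mxtrace_mulC mulmxA UU'.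
by rewrite mul1mx.
Qed.

(** On the default branch the converse is required: for [a != 0], a root for [a *: A] rescales to
    one for [A]. The case a = 0 stands apart, since 0 always has the root 0. *)
Lemma absmxZ n (a : C) (A : 'M[C]_n) : absmx (a *: A) = `|a| *: absmx A.
Proof.
have sqZ (b : C) (P B : 'M[C]_n) : P *m P = B ->
    (`|b| *: P) *m (`|b| *: P) = (b * Num.conj b) *: B.
  by move=> <-; rewrite -scalemxAl -scalemxAr scalerA -normCK.
have AZ : (a *: A) ^t* *m (a *: A) = (a * Num.conj a) *: (A ^t* *m A).
  by rewrite adjmxZ -scalemxAl -scalemxAr scalerA mulrC.
case: (absmx_id A) => [[Pp PA]|[-> noA]].
  by apply: absmxE; [exact: psdmxZ|rewrite AZ; exact: sqZ].
rewrite scaler0; have [a0|an0] := eqVneq a 0.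
  rewrite a0 scale0r; apply: absmxE; [exact: psdmx0|by rewrite !mulmx0].
case: (absmx_id (a *: A)) => [[]|[]//]; set P := absmx _ => Pp.
rewrite AZ => PE; exfalso.
apply: (noA (`|a^-1| *: P)); first exact: psdmxZ.
by rewrite (sqZ _ _ _ PE) scalerA mulrACA -rmorphM mulVf // rmorph1 mulr1 scale1r.
Qed.

Lemma trace_normZ n (a : C) (A : 'M[C]_n) :
  trace_norm (a *: A) = complex.Re `|a| * trace_norm A.
Proof. by rewrite /trace_norm absmxZ mxtraceZ normc_def; case: (\tr _) => x y /=; rewrite mul0r subr0. Qed.

End PositiveMatrices.

(** * Linear maps, states and star-homomorphisms *)

Section LinearMaps.
Variables (R : realType) (V W : lmodType R[i]) (f : V -> W).
Hypothesis lf : linear_map f.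

Lemma linear_mapD : {morph f : x y / x + y}.
Proof. by move=> x y; have := lf 1 x y; rewrite !scale1r. Qed.

Lemma linear_map0 : f 0 = 0.
Proof. by apply: (@addrI _ (f 0)); rewrite -linear_mapD !addr0. Qed.

Lemma linear_mapZ c x : f (c *: x) = c *: f x.
Proof. by have := lf c x 0; rewrite linear_map0 !addr0. Qed.

Lemma linear_mapB : {morph f : x y / x - y}.
Proof. by move=> x y; rewrite linear_mapD -scaleN1r linear_mapZ scaleN1r. Qed.

Lemma linear_map_sum I (r : seq I) (P : pred I) (F : I -> V) :
  f (\sum_(i <- r | P i) F i) = \sum_(i <- r | P i) f (F i).
Proof. exact: (big_morph f linear_mapD linear_map0). Qed.

End LinearMaps.

Section CstarFacts.
Variables (R : realType) (A : cstarAlgType R).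
Implicit Types x y : A.

Lemma star0 : star (0 : A) = 0.
Proof. by have := starZ 0 (0 : A); rewrite !scale0r rmorph0 scale0r. Qed.

Lemma star1 : star (1 : A) = 1.
Proof. by rewrite -[LHS]mulr1 -{2}(starK (1 : A)) -starM mulr1 starK. Qed.

Lemma starN x : star (- x) = - star x.
Proof. by rewrite -[- x]scaleN1r starZ rmorphN1 scaleN1r. Qed.

Lemma star_sum I (r : seq I) (P : pred I) (F : I -> A) :
  star (\sum_(i <- r | P i) F i) = \sum_(i <- r | P i) star (F i).
Proof. exact: (big_morph _ (@starD _ A) star0). Qed.

End CstarFacts.

(** The choices c = 1 and c = i show that p + q and i(p - q) are real. This is how positivity of a
    state makes it hermitian. *)
Lemma conj_of_polarization (C : numClosedFieldType) (p q : C) :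
  (forall c, Num.conj (c * p + Num.conj c * q) = c * p + Num.conj c * q) ->
  q = Num.conj p.
Proof.
move=> pq; have := pq 1; have := pq 'i%R.
rewrite conjCi conjC1 !mul1r mulNr !(rmorphB, rmorphD) /= !rmorphM /= conjCi => Hi H1.
apply: (canRL (@conjCK C)).
have {}Hi : - Num.conj p + Num.conj q = p - q.
  by apply: (mulfI (neq0Ci C)); rewrite [RHS]mulrBr -Hi; ring.
apply: (mulIf (_ : 2 != 0 :> C)); first by rewrite pnatr_eq0.
have -> : Num.conj q * 2 = (- Num.conj p + Num.conj q) + (Num.conj p + Num.conj q).
  by ring.
by rewrite Hi H1; ring.
Qed.

Section States.
Variables (R : realType) (A : cstarAlgType R) (h : A -> R[i]).
Hypothesis sh : state h.

Lemma state_linear : linear_map (h : A -> R[i]^o).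
Proof. by case: sh. Qed.

Lemma state0 : h 0 = 0.
Proof. exact: (linear_map0 state_linear). Qed.

Lemma stateD : {morph h : x y / x + y}.
Proof. exact: (linear_mapD state_linear). Qed.

Lemma stateB : {morph h : x y / x - y}.
Proof. exact: (linear_mapB state_linear). Qed.

Lemma stateN : {morph h : x / - x}.
Proof. by move=> x; have := stateB 0 x; rewrite !sub0r state0 sub0r. Qed.

Lemma stateZ c x : h (c *: x) = c * h x.
Proof. exact: (linear_mapZ state_linear). Qed.

Lemma state_sum I (r : seq I) (P : pred I) (F : I -> A) :
  h (\sum_(i <- r | P i) F i) = \sum_(i <- r | P i) h (F i).
Proof. exact: (linear_map_sum state_linear). Qed.

Lemma state1 : h 1 = 1.
Proof. by case: sh. Qed.

Lemma state_alg c : h c%:A = c.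
Proof. by rewrite stateZ state1 mulr1. Qed.

Lemma state_ge0 x : 0 <= h (star x * x).
Proof. by case: sh. Qed.

Lemma state_star x : h (star x) = Num.conj (h x).
Proof.
have real1 c : Num.conj (c * h x + Num.conj c * h (star x)) =
    c * h x + Num.conj c * h (star x).
  (* A combination of values of h at the positive elements built from 1 + cx, 1 and cx, hence
     real. *)
  have -> : c * h x + Num.conj c * h (star x) =
      h (star (1 + c *: x) * (1 + c *: x)) - 1 - h (star (c *: x) * (c *: x)).
    rewrite starD star1 starZ mulrDl !mulrDr !mul1r !mulr1 !stateD state1 !stateZ.
    by ring.
  by apply/CrealP; rewrite !rpredB ?rpred1 ?ger0_real ?state_ge0 //.
exact: conj_of_polarization.
Qed.

End States.

Section StarHom.
Variables (R : realType) (A B : cstarAlgType R) (f : A -> B).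
Hypothesis hf : unital_star_hom f.

Lemma star_hom_linear : linear_map f. Proof. by case: hf. Qed.
Lemma star_homM : {morph f : x y / x * y}. Proof. by case: hf. Qed.
Lemma star_hom1 : f 1 = 1. Proof. by case: hf. Qed.
Lemma star_hom_star x : f (star x) = star (f x). Proof. by case: hf. Qed.

Lemma star_hom_alg c : f c%:A = c%:A.
Proof. by rewrite (linear_mapZ star_hom_linear) star_hom1. Qed.

End StarHom.

(** * Intertwiners and Schur's lemma *)

Section Intertwiners.
Variables (R : realType) (G : cqg R).
Local Notation C := R[i].
Local Notation amp := (amp_mx G).

(** Unitarity on its own, a property that a unital star-homomorphism passes on to the image
    matrix. *)
Definition unitary_mx n (u : 'M[cqg_A G]_n) : Prop :=
  u *m adj_mx u = 1%:M /\ adj_mx u *m u = 1%:M.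

Lemma unitary_rep_mx n (u : 'M[cqg_A G]_n) : unitary_rep u -> unitary_mx u.
Proof. by case. Qed.

Lemma amp_mxE m n (X : 'M[C]_(m, n)) i j : amp X i j = (X i j)%:A.
Proof. by rewrite mxE. Qed.

Lemma amp_mxM m n p (X : 'M[C]_(m, n)) (Y : 'M[C]_(n, p)) :
  amp (X *m Y) = amp X *m amp Y.
Proof. exact: (map_mxM (in_alg (cqg_A G))). Qed.

Lemma amp_mx_scalar n (a : C) : amp (a%:M : 'M[C]_n) = (a%:A)%:M.
Proof. exact: (map_scalar_mx (in_alg (cqg_A G))). Qed.

Lemma amp_mx1 n : amp (1%:M : 'M[C]_n) = 1%:M.
Proof. by rewrite amp_mx_scalar scale1r. Qed.

Lemma amp_mulmxE m n p (X : 'M[C]_(m, n)) (u : 'M[cqg_A G]_(n, p)) i j :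
  (amp X *m u) i j = \sum_k X i k *: u k j.
Proof. by rewrite mxE; apply: eq_bigr => k _; rewrite amp_mxE mulr_algl. Qed.

Lemma mulmx_ampE m n p (u : 'M[cqg_A G]_(m, n)) (X : 'M[C]_(n, p)) i j :
  (u *m amp X) i j = \sum_k X k j *: u i k.
Proof. by rewrite mxE; apply: eq_bigr => k _; rewrite amp_mxE mulr_algr. Qed.

Lemma star_amp m n (X : 'M[C]_(m, n)) : adj_mx (amp X) = amp (X ^t*).
Proof. by apply/matrixP=> i j; rewrite !mxE starZ star1. Qed.

Lemma adj_mxM m n p (u : 'M[cqg_A G]_(m, n)) (v : 'M[cqg_A G]_(n, p)) :
  adj_mx (u *m v) = adj_mx v *m adj_mx u.
Proof.
apply/matrixP=> i j; rewrite !mxE star_sum; apply: eq_bigr => k _.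
by rewrite !mxE starM.
Qed.

(** Take adjoints in Xu = vX, then multiply by u on the left and by v on the right. *)
Lemma intertwiner_adj m n (u : 'M[cqg_A G]_m) (v : 'M[cqg_A G]_n)
    (X : 'M[C]_(n, m)) : unitary_mx u -> unitary_mx v ->
  intertwiner u v X -> intertwiner v u (X ^t*).
Proof.
move=> [uu _] [_ vv] /(congr1 (@adj_mx _ _ _ _)).
rewrite !adj_mxM star_amp => E; rewrite /intertwiner.
rewrite -[LHS]mul1mx -uu -mulmxA (mulmxA (adj_mx u)) E.
by rewrite -(mulmxA (amp _)) vv mulmx1.
Qed.

Lemma intertwiner_comp m n p (u : 'M[cqg_A G]_m) (v : 'M[cqg_A G]_n)
    (w : 'M[cqg_A G]_p) (X : 'M[C]_(n, m)) (Y : 'M[C]_(p, n)) :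
  intertwiner u v X -> intertwiner v w Y -> intertwiner u w (Y *m X).
Proof.
by move=> Xi Yi; rewrite /intertwiner !amp_mxM -mulmxA Xi mulmxA Yi mulmxA.
Qed.

Lemma intertwinerZ m n (u : 'M[cqg_A G]_m) (v : 'M[cqg_A G]_n)
    (X : 'M[C]_(n, m)) (a : C) : intertwiner u v X -> intertwiner u v (a *: X).
Proof.
move=> Xi; rewrite -mul_scalar_mx /intertwiner amp_mxM -mulmxA Xi.
rewrite mulmxA [RHS]mulmxA; congr (_ *m _).
apply/matrixP=> i j; rewrite amp_mulmxE mulmx_ampE.
rewrite (bigD1 i) //= big1 ?addr0; last first.
  by move=> k ki; rewrite mxE eq_sym (negbTE ki) scale0r.
rewrite (bigD1 j) //= big1 ?addr0; last first.
  by move=> k kj; rewrite mxE (negbTE kj) scale0r.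
by rewrite !mxE !eqxx.
Qed.

Lemma equiv_rep_sym m n (u : 'M[cqg_A G]_m) (v : 'M[cqg_A G]_n) :
  equiv_rep u v -> equiv_rep v u.
Proof.
move=> [X [Y [Xi XY YX]]]; exists Y, X; split=> //.
rewrite /intertwiner -[LHS]mulmx1 -amp_mx1 -XY amp_mxM.
by rewrite mulmxA -(mulmxA (amp Y)) -Xi mulmxA -amp_mxM YX amp_mx1 mul1mx.
Qed.

Lemma equiv_rep_trans m n p (u : 'M[cqg_A G]_m) (v : 'M[cqg_A G]_n)
    (w : 'M[cqg_A G]_p) : equiv_rep u v -> equiv_rep v w -> equiv_rep u w.
Proof.
move=> [X [Y [Xi XY YX]]] [X' [Y' [Xi' XY' YX']]].
exists (X' *m X), (Y *m Y'); split; first exact: intertwiner_comp Xi Xi'.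
  by rewrite mulmxA -(mulmxA X') XY mulmx1.
by rewrite mulmxA -(mulmxA Y) YX' mulmx1.
Qed.

(** For an invertible intertwiner X, irreducibility of v makes X times its adjoint a scalar a > 0,
    so X divided by the square root of a is unitary. *)
Lemma unitary_intertwiner m n (u : 'M[cqg_A G]_m) (v : 'M[cqg_A G]_n) :
  unitary_mx u -> unitary_mx v -> irreducible_rep v -> equiv_rep u v ->
  exists2 U : 'M[C]_(n, m), U *m U ^t* = 1%:M /\ U ^t* *m U = 1%:M
    & v = amp U *m u *m amp (U ^t*).
Proof.
move=> uu vv [n0 vi] [X [Y [Xi XY YX]]].
have [a aE] : exists a, X *m X ^t* = a%:M.
  exact/vi/(intertwiner_comp (intertwiner_adj uu vv Xi) Xi).
have n00 : 'I_n by exact: Ordinal n0.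
have aX : a = \sum_j `|X n00 j| ^+ 2.
  by rewrite -mulmx_adj_diagE aE mxE eqxx mulr1n.
have a0 : 0 <= a by rewrite aX sumr_ge0 // => j _; rewrite exprn_ge0.
have an0 : a != 0.
  apply/eqP => a00; have X0 : X = 0.
    by apply: mulmx_adj_eq0; rewrite aE a00 raddf0.
  have := congr1 (fun M : 'M[C]_n => M n00 n00) XY.
  by rewrite X0 mul0mx !mxE eqxx => /esym/eqP; rewrite oner_eq0.
pose s := sqrtC a.
have s0 : s != 0 by rewrite sqrtC_eq0.
have sr : Num.conj s^-1 = s^-1.
  by apply/CrealP/ger0_real; rewrite invr_ge0 sqrtC_ge0.
have ss : s^-1 * s^-1 * a = 1.
  by rewrite -(sqrtCK a) -/s expr2 -invfM mulVf // mulf_neq0.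
(* The inverse Y of X shows that the adjoint of X is aY, so the product in the other order is a as
   well. *)
have XX : X ^t* *m X = a%:M.
  rewrite -[X ^t*]mul1mx -YX -(mulmxA Y) aE mul_mx_scalar -scalemxAl YX.
  by rewrite scalemx1.
have U1 : (s^-1 *: X) *m (s^-1 *: X) ^t* = 1%:M.
  rewrite adjmxZ sr -scalemxAl -scalemxAr aE scalerA.
  by rewrite -mul_scalar_mx -scalar_mxM ss.
have U2 : (s^-1 *: X) ^t* *m (s^-1 *: X) = 1%:M.
  rewrite adjmxZ sr -scalemxAl -scalemxAr XX scalerA.
  by rewrite -mul_scalar_mx -scalar_mxM ss.
exists (s^-1 *: X) => //.
by rewrite (intertwinerZ s^-1 Xi) -mulmxA -amp_mxM U1 amp_mx1 mulmx1.
Qed.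

(** Irreducibility of v and of u makes both products of X with its adjoint scalar. They are nonzero
    with X, so X has an inverse on each side. *)
Lemma schur_equiv m n (u : 'M[cqg_A G]_m) (v : 'M[cqg_A G]_n)
    (X : 'M[C]_(n, m)) : unitary_mx u -> unitary_mx v ->
  irreducible_rep u -> irreducible_rep v ->
  intertwiner u v X -> X != 0 -> equiv_rep u v.
Proof.
move=> uu vv [_ ui] [_ vi] Xi X0.
have Xi' := intertwiner_adj uu vv Xi.
have [a aE] : exists a, X *m X ^t* = a%:M by exact/vi/(intertwiner_comp Xi' Xi).
have [b bE] : exists b, X ^t* *m X = b%:M by exact/ui/(intertwiner_comp Xi Xi').
have a0 : a != 0.
  by apply: contra_neq X0 => a0; apply: mulmx_adj_eq0; rewrite aE a0 raddf0.
have b0 : b != 0.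
  apply: contra_neq X0 => b0; rewrite -[X]trmxCK [X ^t*]mulmx_adj_eq0.
    by rewrite trmx0 map_mx0.
  by rewrite trmxCK bE b0 raddf0.
exists X, (a^-1 *: X ^t*).
have XY : X *m (a^-1 *: X ^t*) = 1%:M.
  by rewrite -scalemxAr aE scale_scalar_mx mulVf.
have Y'X : (b^-1 *: X ^t*) *m X = 1%:M.
  by rewrite -scalemxAl bE scale_scalar_mx mulVf.
split=> //; suff -> : a^-1 *: X ^t* = b^-1 *: X ^t* by [].
by rewrite -[LHS]mul1mx -Y'X -mulmxA XY mulmx1.
Qed.

(** Every matrix commutes with the identity, so beyond dimension 1 a matrix unit would be a
    non-scalar self-intertwiner. *)
Lemma irreducible_scalar_dim n :
  irreducible_rep (1%:M : 'M[cqg_A G]_n) -> n = 1%N.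
Proof.
case: n => [|[|n]] [] // _ irr.
have [c cE] : exists c, delta_mx 0 0 = c%:M :> 'M[C]_n.+2.
  by apply: irr; rewrite /intertwiner mulmx1 mul1mx.
have := congr1 (fun M : 'M[C]_n.+2 => M 0 0) cE.
have := congr1 (fun M : 'M[C]_n.+2 => M ord_max ord_max) cE.
by rewrite !mxE !eqxx !mulr1n /= => <- /eqP; rewrite oner_eq0.
Qed.

End Intertwiners.

(** * Orthogonality relations from Haar invariance *)

Section Haar.
Variables (R : realType) (G : cqg R) (h : cqg_A G -> R[i]).
Hypothesis haar : haar_state h.
Local Notation C := R[i].
Local Notation amp := (amp_mx G).

Let sh : state h. Proof. by case: haar. Qed.

(** Write Y for the matrix of Haar values. Slicing the comultiplication of [star (u j i) * v k l] by
    h in the first leg expresses invariance as [adj_mx u *m (amp Y *m v) = amp Y]; multiplying by u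
    gives the intertwining relation. *)
Lemma haar_average m n (u : 'M[cqg_A G]_m) (v : 'M[cqg_A G]_n) j k :
  unitary_rep u -> unitary_rep v ->
  intertwiner v u (\matrix_(i, l) h (star (u j i) * v k l)).
Proof.
move=> [uu _ uD] [_ _ vD]; set Y := \matrix_(i, l) _.
have [_ [Sl [Sr [[Sll _] _ SlE _ Slh]]]] := haar.
have ct : cstar_tensor (@tens _ G) by case: (@tens_min _ G).
suff fixY : adj_mx u *m (amp Y *m v) = amp Y.
  by rewrite /intertwiner -[in RHS]fixY mulmxA uu mul1mx.
apply/matrixP => i l; rewrite [RHS]mxE [Y i l]mxE -(Slh _).1.
have -> : Delta (star (u j i) * v k l) = \sum_a \sum_b
    tens (star (u j a) * v k b) (star (u a i) * v b l).
  have hD := Delta_hom G.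
  rewrite (star_homM hD) (star_hom_star hD) uD vD star_sum mulr_suml.
  apply: eq_bigr => a _; rewrite mulr_sumr; apply: eq_bigr => b _.
  by rewrite (ct_star ct) (ct_mul ct).
rewrite (linear_map_sum Sll) mxE; apply: eq_bigr => a _.
rewrite amp_mulmxE (linear_map_sum Sll) mulr_sumr; apply: eq_bigr => b _.
by rewrite SlE !mxE scalerAr.
Qed.

Lemma irreducible_orthogonal m n (u : 'M[cqg_A G]_m) (v : 'M[cqg_A G]_n) i j k l :
  unitary_rep u -> unitary_rep v -> irreducible_rep u -> irreducible_rep v ->
  ~ equiv_rep v u -> h (star (u j i) * v k l) = 0.
Proof.
move=> uu vv ui vi nuv; have Yi := haar_average j k uu vv.
have Y0 : \matrix_(i, l) h (star (u j i) * v k l) = 0.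
  apply/eqP; apply: contra_notT nuv.
  exact: schur_equiv (unitary_rep_mx vv) (unitary_rep_mx uu) vi ui Yi.
by have := congr1 (fun M : 'M[C]_(m, n) => M i l) Y0; rewrite !mxE.
Qed.

(* The matrix [h (u i j)] intertwines [u] with itself and absorbs it. *)
Lemma irreducible_centered n (u : 'M[cqg_A G]_n) :
  unitary_rep u -> irreducible_rep u ->
  (forall i j, h (u i j) = 0) \/ u = 1%:M.
Proof.
move=> [_ _ uD] [_ ui]; pose P := map_mx h u.
have [_ [Sl [Sr [[Sll _] [Srl _] SlE SrE Sh]]]] := haar.
have Pu : amp P *m u = amp P.
  apply/matrixP=> i j; rewrite amp_mulmxE [RHS]mxE [P i j]mxE -(Sh _).1 uD.
  by rewrite (linear_map_sum Sll); apply: eq_bigr => k _; rewrite SlE mxE.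
have uP : u *m amp P = amp P.
  apply/matrixP=> i j; rewrite mulmx_ampE [RHS]mxE [P i j]mxE -(Sh _).2 uD.
  by rewrite (linear_map_sum Srl); apply: eq_bigr => k _; rewrite SrE mxE.
have [c cE] : exists c, P = c%:M by apply: ui; rewrite /intertwiner Pu uP.
have [c0|c0] := eqVneq c 0.
  left=> i j; have := congr1 (fun M : 'M[C]_n => M i j) cE.
  by rewrite !mxE c0 mul0rn.
right; rewrite -[u]mul1mx -amp_mx1 -(mulVf c0) scalar_mxM -cE amp_mxM.
by rewrite -mulmxA Pu -amp_mxM cE -scalar_mxM mulVf // amp_mx1.
Qed.

(** Division by a zero trace returns 0, so all the values in the Haar formula would vanish, while
    unitarity makes a sum of them equal to h 1 = 1. *)
Lemma modular_trace_neq0 n (u : 'M[cqg_A G]_n) Q :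
  (0 < n)%N -> unitary_mx u -> modular_mx h u Q -> \tr Q != 0.
Proof.
move=> n0 [_ uu] [_ _ _ Qh]; apply/eqP => Q0.
have := congr1 (fun M : 'M[cqg_A G]_n => h (M (Ordinal n0) (Ordinal n0))) uu.
rewrite !mxE eqxx (state1 sh) (state_sum sh) big1; last first.
  by move=> k _; rewrite !mxE Qh Q0 invr0 mulr0.
by move/esym/eqP; rewrite oner_eq0.
Qed.

(** The Haar formula determines the inverse of Q up to the factor tr Q / tr Q'. Hence Q' is that
    multiple of Q, and comparing traces gives equal squares of two nonnegative numbers. *)
Lemma modular_unique n (u : 'M[cqg_A G]_n) Q Q' :
  (0 < n)%N -> unitary_mx u -> modular_mx h u Q -> modular_mx h u Q' -> Q = Q'.
Proof.
move=> n0 uu Qm Qm'.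
have q0 := modular_trace_neq0 n0 uu Qm; have q0' := modular_trace_neq0 n0 uu Qm'.
case: Qm Qm' => [Qp Qu Qt Qh] [Qp' Qu' Qt' Qh'].
have invE : invmx Q = (\tr Q / \tr Q') *: invmx Q'.
  apply/matrixP=> l i; rewrite mxE.
  have := Qh i (Ordinal n0) l (Ordinal n0); rewrite Qh' eqxx !mul1r => E.
  by rewrite -[LHS](divfK q0) -E; field.
have QE : Q' = (\tr Q / \tr Q') *: Q.
  by rewrite -[LHS]mul1mx -(mulmxV Qu) invE -scalemxAr -scalemxAl -mulmxA mulVmx // mulmx1.
have /eqP : \tr Q' ^+ 2 = \tr Q ^+ 2.
  rewrite expr2 {1}QE mxtraceZ; by field.
rewrite eqrXn2 ?psdmx_trace_ge0 // => /eqP tE.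
by rewrite QE tE divff // scale1r.
Qed.

End Haar.

(** * Transport of unitarity and of the modular matrix along an embedding *)

Section Functionals.
Variables (R : realType) (G : cqg R).
Local Notation C := R[i].
Local Notation amp := (amp_mx G).

Lemma map_functional_amp (f : cqg_A G -> C) m n p q (A : 'M[C]_(m, n))
    (u : 'M[cqg_A G]_(n, p)) (B : 'M[C]_(p, q)) :
  linear_map (f : cqg_A G -> C^o) ->
  map_mx f (amp A *m u *m amp B) = A *m map_mx f u *m B.
Proof.
move=> lf; apply/matrixP=> i j; rewrite mxE mulmx_ampE (linear_map_sum lf) mxE.
apply: eq_bigr => k _; rewrite (linear_mapZ lf) mulrC amp_mulmxE.
rewrite (linear_map_sum lf) mxE; congr (_ * _); apply: eq_bigr => l _.
by rewrite (linear_mapZ lf) mxE.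
Qed.

End Functionals.

Section Transport.
Variables (R : realType) (G1 G : cqg R).
Variables (h1 : cqg_A G1 -> R[i]) (h : cqg_A G -> R[i]) (j : cqg_A G1 -> cqg_A G).
Hypothesis sh : state h.
Hypotheses (hj : unital_star_hom j) (hjE : forall x, h (j x) = h1 x).
Local Notation C := R[i].
Local Notation amp := (amp_mx G).

Lemma unitary_map m (u : 'M[cqg_A G1]_m) :
  unitary_mx u -> unitary_mx (map_mx j u).
Proof.
have adjE : adj_mx (map_mx j u) = map_mx j (adj_mx u).
  by apply/matrixP=> a b; rewrite !mxE (star_hom_star hj).
have mulE (v w : 'M[cqg_A G1]_m) : map_mx j v *m map_mx j w = map_mx j (v *m w).
  apply/matrixP=> a b; rewrite !mxE (linear_map_sum (star_hom_linear hj)).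
  by apply: eq_bigr => c _; rewrite !mxE (star_homM hj).
have oneE : map_mx j 1%:M = 1%:M :> 'M[cqg_A G]_m.
  apply/matrixP=> a b; rewrite !mxE; case: eqP => _; first exact: star_hom1.
  exact: (linear_map0 (star_hom_linear hj)).
by move=> [uu uu']; split; rewrite adjE mulE ?uu ?uu' oneE.
Qed.

(** The Haar formula is sesquilinear in the coefficients: first the right factor is expanded in
    those of [map_mx j u] ([inner]), then the left one. *)
Lemma modular_transport m n (u : 'M[cqg_A G1]_m) (v : 'M[cqg_A G]_n)
    (U : 'M[C]_(n, m)) Q :
  U *m U ^t* = 1%:M -> U ^t* *m U = 1%:M ->
  v = amp U *m map_mx j u *m amp (U ^t*) ->
  modular_mx h1 u Q -> modular_mx h v (U *m Q *m U ^t*).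
Proof.
move=> UU UU' vE [Qp Qu Qt Qh].
have trE (S : 'M[C]_m) : \tr (U *m S *m U ^t*) = \tr S.
  by rewrite mxtrace_mulC mulmxA UU' mul1mx.
have QV : U *m Q *m U ^t* *m (U *m invmx Q *m U ^t*) = 1%:M.
  rewrite !mulmxA -[_ *m U ^t* *m U]mulmxA UU' mulmx1.
  by rewrite -[_ *m Q *m invmx Q]mulmxA mulmxV // mulmx1 UU.
have [QU _] := mulmx1_unit QV.
have invE : invmx (U *m Q *m U ^t*) = U *m invmx Q *m U ^t*.
  by rewrite -[LHS]mulmx1 -QV (mulmxA (invmx _)) mulVmx // mul1mx.
split=> //; [exact: psdmx_conj|by rewrite invE !trE|].
move=> i b l d; rewrite invE trE.
have left_lin y : linear_map ((fun x => h (x * y)) : cqg_A G -> C^o).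
  by move=> c x x'; rewrite mulrDl -scalerAl (state_linear sh).
have right_lin y : linear_map ((fun x => h (y * x)) : cqg_A G -> C^o).
  by move=> c x x'; rewrite mulrDr -scalerAr (state_linear sh).
have vstarE : adj_mx v = amp U *m adj_mx (map_mx j u) *m amp (U ^t*).
  by rewrite vE !adj_mxM !star_amp trmxCK mulmxA.
have inner a c : h (star (j (u a c)) * v l d) =
    Num.conj (U d c) * (U *m invmx Q) l a / \tr Q.
  have := map_functional_amp U (map_mx j u) (U ^t*) (right_lin (star (j (u a c)))).
  move/(congr1 (fun M : 'M[C]_n => M l d)); rewrite -vE mxE => ->.
  rewrite mxE (bigD1 c) //= big1 ?addr0; last first.
    move=> k kc; rewrite [X in X * _]mxE big1 ?mul0r // => s _.
    rewrite !mxE -(star_hom_star hj) -(star_homM hj) hjE Qh eq_sym (negbTE kc).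
    by rewrite !mul0r mulr0.
  have -> : (U ^t*) c d = Num.conj (U d c) by rewrite !mxE.
  rewrite mulrC -[RHS]mulrA; congr (_ * _).
  rewrite [LHS]mxE [X in X / _]mxE mulr_suml; apply: eq_bigr => s _.
  by rewrite !mxE -(star_hom_star hj) -(star_homM hj) hjE Qh eqxx mul1r mulrA.
have := map_functional_amp U (adj_mx (map_mx j u)) (U ^t*) (left_lin (v l d)).
move/(congr1 (fun M : 'M[C]_n => M b i)); rewrite -vstarE mxE [adj_mx v b i]mxE [_^T b i]mxE => ->.
rewrite mxE; transitivity (\sum_a \sum_c U b c * Num.conj (U d c) *
    ((U *m invmx Q) l a * Num.conj (U i a)) / \tr Q).
  apply: eq_bigr => a _.
  have -> : (U ^t*) a i = Num.conj (U i a) by rewrite !mxE.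
  rewrite [X in X * _]mxE mulr_suml; apply: eq_bigr => c _.
  have adjE : adj_mx (map_mx j u) c a = star (j (u a c)) by rewrite !mxE.
  by rewrite mxE adjE inner; ring.
(* The sum over c is the entry (b, d) of U times its adjoint, which is the identity. *)
transitivity (\sum_a (b == d)%:R * ((U *m invmx Q) l a * Num.conj (U i a)) / \tr Q).
  apply: eq_bigr => a _; rewrite -!mulr_suml; congr (_ * _ * _).
  have := congr1 (fun M : 'M[C]_n => M b d) UU; rewrite !mxE => <-.
  by apply: eq_bigr => c _; rewrite !mxE.
rewrite -mulr_suml -mulr_sumr; congr (_ * _ * _); rewrite [RHS]mxE.
by apply: eq_bigr => a _; rewrite !mxE.
Qed.

End Transport.

(** * Estimates in the GNS space *)

Section GnsNorm.
Variables (R : realType) (A : cstarAlgType R) (h : A -> R[i]).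
Hypothesis sh : state h.

Lemma gns_norm_ge0 x : (0 <= gns_norm h x)%E.
Proof.
apply: le_trans (_ : (Num.sqrt (complex.Re (h (star (x * 1) * (x * 1)))))%:E <= _)%E.
  by rewrite lee_fin sqrtr_ge0.
by apply: ereal_sup_ubound; exists 1 => //=; rewrite mulr1 star1 (state1 sh).
Qed.

Lemma ge0_Re (c : R[i]) : 0 <= c -> c = (complex.Re c)%:C.
Proof. by case: c => a b; rewrite lecE /= => /andP[/eqP -> _]. Qed.

Lemma gns_norm_act (N : R) x y : gns_norm h x = N%:E -> h (star y * y) <= 1 ->
  h (star (x * y) * (x * y)) <= (N ^+ 2)%:C.
Proof.
move=> xN y1; have N0 : 0 <= N by rewrite -lee_fin -xN gns_norm_ge0.
have pos := state_ge0 sh (x * y).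
rewrite (ge0_Re pos) lecR -[X in X <= _]sqr_sqrtr; last first.
  by move: pos; rewrite lecE => /andP[].
rewrite ler_pXn2r ?nnegrE ?sqrtr_ge0 // -lee_fin -xN.
by apply: ereal_sup_ubound; exists y.
Qed.

Lemma gns_norm_le (N : R) x : 0 <= N ->
  (forall y, h (star y * y) <= 1 -> h (star (x * y) * (x * y)) <= (N ^+ 2)%:C) ->
  (gns_norm h x <= N%:E)%E.
Proof.
move=> N0 xN; apply: ge_ereal_sup => _ [y /= y1 <-]; rewrite lee_fin.
rewrite -(ger0_norm N0) -sqrtr_sqr ler_wsqrtr // -lecR -ge0_Re ?state_ge0 //.
exact: xN.
Qed.

(** Parallelogram law: the right side minus the left is the value at x + y. *)
Lemma state_sqB x y : h (star (x - y) * (x - y)) <=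
  2 * h (star x * x) + 2 * h (star y * y).
Proof.
have E : 2 * h (star x * x) + 2 * h (star y * y) - h (star (x - y) * (x - y)) =
    h (star (x + y) * (x + y)).
  rewrite !starD starN !(mulrDl, mulrDr) !(mulrN, mulNr) opprK.
  by rewrite !(stateD sh, stateN sh); ring.
by rewrite -subr_ge0 E state_ge0.
Qed.

Lemma state_sqZ c x : h (star (c *: x) * (c *: x)) = `|c| ^+ 2 * h (star x * x).
Proof.
by rewrite starZ -scalerAl -scalerAr scalerA (stateZ sh) mulrC normCK mulrC [c * _]mulrC.
Qed.

(** A centered x is orthogonal to 1 in the GNS space, so the cross terms vanish. *)
Lemma state_sq_center c x : h x = 0 ->
  h (star (x + c%:A) * (x + c%:A)) = h (star x * x) + `|c| ^+ 2.
Proof.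
move=> x0; rewrite starD mulrDl !mulrDr starZ star1 !mulr_algl mulr_algr.
rewrite !(stateD sh) !(stateZ sh) (state_star sh) x0 rmorph0 (state1 sh) normCK.
by ring.
Qed.

End GnsNorm.

(** * Norm bounds from freeness *)

Lemma free_pair_sym (R : realType) (A : cstarAlgType R) (h : A -> R[i])
    (B1 B2 : set A) : free_pair h B1 B2 -> free_pair h B2 B1.
Proof.
(* Flipping the labels of the letters keeps a word alternating and leaves its product unchanged. *)
move=> fr w w0 ws wB; pose f (p : bool * A) := (~~ p.1, p.2).
have := fr (map f w); rewrite big_map /=; apply.
- by case: w w0 {ws wB}.
- rewrite sorted_map; apply: sub_sorted ws => p q /=.
  by case: p.1; case: q.1.
- move=> _ /mapP[p pw ->] /=; have := wB p pw; by case: p.1.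
Qed.

Section FreeProduct.
Variables (R : realType) (A1 A2 A : cstarAlgType R).
Variables (h1 : A1 -> R[i]) (h2 : A2 -> R[i]) (h : A -> R[i]).
Variables (j1 : A1 -> A) (j2 : A2 -> A).
Hypotheses (sh1 : state h1) (sh : state h).
Hypothesis hj1 : unital_star_hom j1.
Hypotheses (hj1E : forall x, h (j1 x) = h1 x) (hj2E : forall x, h (j2 x) = h2 x).
Hypothesis fr : free_pair h (range j1) (range j2).

(** Splitting a and b into centered and scalar parts leaves four words, each alternating in centered
    letters and containing [j2 z]; freeness kills all of them. *)
Lemma free_mixed a z b : h2 z = 0 -> h (j1 a * j2 z * j1 b) = 0.
Proof.
move=> z0.
have center c : exists2 c0, h1 c0 = 0 & j1 c = j1 c0 + (h1 c)%:A.
  exists (c - (h1 c)%:A); first by rewrite (stateB sh1) (state_alg sh1) subrr.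
  by rewrite (linear_mapB (star_hom_linear hj1)) (star_hom_alg hj1) subrK.
have [a0 ha0 ->] := center a; have [b0 hb0 ->] := center b.
have word s : s != [::] -> sorted (fun p q : bool * A => p.1 != q.1) s ->
    all (mem [:: (true, j1 a0); (false, j2 z); (true, j1 b0)]) s ->
    h (\prod_(p <- s) p.2) = 0.
  move=> s0 ss sa; apply: fr => // p /(allP sa).
  rewrite !inE => /or3P[] /eqP -> /=.
  - by split; [exists a0|rewrite hj1E].
  - by split; [exists z|rewrite hj2E].
  - by split; [exists b0|rewrite hj1E].
have w3 := word [:: (true, j1 a0); (false, j2 z); (true, j1 b0)].
have w2l := word [:: (true, j1 a0); (false, j2 z)].
have w2r := word [:: (false, j2 z); (true, j1 b0)].
have w1 := word [:: (false, j2 z)].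
move: w3 w2l w2r w1; rewrite !big_cons !big_nil /= !mulr1 !inE !eqxx !orbT /=.
move=> /(_ isT isT isT) w3 /(_ isT isT isT) w2l /(_ isT isT isT) w2r.
move=> /(_ isT isT isT) w1.
rewrite mulrDl mulr_algl mulrDl !mulrDr !mulr_algr -!scalerAl -mulrA.
by rewrite !(stateD sh) !(stateZ sh) w3 w2l w2r w1 !(mulr0, addr0).
Qed.

Lemma free_compression y z c a : h2 z = 0 ->
  h1 (star ((y + c%:A) * a) * ((y + c%:A) * a)) <=
  h (star ((j1 y + j2 z + c%:A) * j1 a) * ((j1 y + j2 z + c%:A) * j1 a)).
Proof.
move=> z0; have -> : (j1 y + j2 z + c%:A) * j1 a =
    j1 ((y + c%:A) * a) + j2 z * j1 a.
  rewrite (star_homM hj1) (linear_mapD (star_hom_linear hj1)) (star_hom_alg hj1).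
  by rewrite addrAC mulrDl.
set p := j1 _; set q := j2 z * j1 a.
have pq : h (star p * q) = 0.
  by rewrite /p /q -(star_hom_star hj1) mulrA free_mixed.
have qp : h (star q * p) = 0.
  by rewrite -[p]starK -starM (state_star sh) pq rmorph0.
have -> : h (star (p + q) * (p + q)) = h (star p * p) + h (star q * q).
  by rewrite starD mulrDl !mulrDr !(stateD sh) pq qp addr0 add0r.
rewrite -hj1E (star_homM hj1) (star_hom_star hj1).
by rewrite lerDl state_ge0.
Qed.

(** Test on the vector 1: since y is centered, |c|^2 is at most the square of y + c, which
    compression bounds by the square of the whole element. *)
Lemma free_mean_bound y z c : h1 y = 0 -> h2 z = 0 ->
  ((complex.Re `|c|)%:E <= gns_norm h (j1 y + j2 z + c%:A)%R)%E.
Proof.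
move=> y0 z0; have := gns_norm_ge0 sh (j1 y + j2 z + c%:A).
case E : (gns_norm _ _) => [N| |] // N0; last by rewrite leey.
move: N0; rewrite !lee_fin => N0.
have r0 : 0 <= complex.Re `|c| by rewrite -lecR -ge0_Re ?normr_ge0.
have := free_compression y c 1 z0.
rewrite (star_hom1 hj1) !mulr1 (state_sq_center sh1) // => le1.
have := @gns_norm_act _ _ _ sh N _ 1 E.
rewrite !mulr1 star1 (state1 sh) => /(_ (lexx _)) le2.
have rE : (complex.Re `|c| ^+ 2)%:C = `|c| ^+ 2.
  by rewrite {2}(ge0_Re (normr_ge0 c)) -rmorphXn.
rewrite -(@ler_pXn2r _ 2) ?nnegrE // -lecR rE.
by apply: le_trans (le_trans le1 le2); rewrite lerDr state_ge0.
Qed.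

Lemma free_component_bound y z c : h1 y = 0 -> h2 z = 0 ->
  (gns_norm h1 y <= 2%:E * gns_norm h (j1 y + j2 z + c%:A)%R)%E.
Proof.
move=> y0 z0; have := gns_norm_ge0 sh (j1 y + j2 z + c%:A).
have := free_mean_bound c y0 z0.
case E : (gns_norm _ _) => [N| |] //; last by rewrite gt0_muley ?leey // lte_fin.
rewrite !lee_fin => cN N0; rewrite -EFinM.
apply: gns_norm_le => [//||a a1]; first by rewrite mulr_ge0.
(* Each of the two terms has GNS length at most N, by compression and by the bound on |c|. The
   parallelogram inequality then gives 2N^2 + 2N^2 = (2N)^2, whence the factor 2. *)
have -> : y * a = (y + c%:A) * a - c *: a by rewrite mulrDl mulr_algl addrK.
apply: le_trans (state_sqB sh1 _ _) _.
have -> : ((2 * N) ^+ 2)%:C = 2 * (N ^+ 2)%:C + 2 * (N ^+ 2)%:C :> R[i].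
  by rewrite exprMn rmorphM /=; ring.
apply: lerD; rewrite ler_wpM2l //.
  apply: le_trans (free_compression y c a z0) _; apply: gns_norm_act => //.
  by rewrite -(star_hom_star hj1) -(star_homM hj1) hj1E.
rewrite (state_sqZ sh1) -[X in _ <= X]mulr1 ler_pM ?exprn_ge0 ?state_ge0 //.
rewrite rmorphXn /= ler_pXn2r ?nnegrE // ?lecR //.
Qed.

End FreeProduct.

(** * Linear spans *)

Section Span.
Variables (R : realType) (V : lmodType R[i]) (S : set V).

Lemma lspan_ind (P : V -> Prop) : P 0 ->
  (forall c x y, P x -> P y -> P (c *: x + y)) -> S `<=` P -> lspan S `<=` P.
Proof.
move=> P0 Plin SP _ [n [c [v [vS ->]]]].
elim/big_ind: _ => // [x y Px Py|k _].
  by rewrite -[x]scale1r; apply: Plin.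
by rewrite -[_ *: _]addr0; apply: Plin => //; exact: SP.
Qed.

Lemma lspan_gen : S `<=` lspan S.
Proof.
move=> x Sx; exists 1%N, (fun=> 1), (fun=> x).
by split=> //; rewrite big_ord1 scale1r.
Qed.

Lemma lspan0 : lspan S 0.
Proof.
exists 0%N, (fun=> 0), (fun=> 0); split; last by rewrite big_ord0.
by case.
Qed.

Lemma lspan_lin c x y : lspan S x -> lspan S y -> lspan S (c *: x + y).
Proof.
move=> [n [a [v [vS ->]]]] [m [b [w [wS ->]]]].
exists (n + m)%N,
  (fun k => match fintype.split k with inl k => c * a k | inr k => b k end),
  (fun k => match fintype.split k with inl k => v k | inr k => w k end).
split=> [k|]; first by case: (fintype.split k).
rewrite big_split_ord /= scaler_sumr; congr (_ + _).
  apply: eq_bigr => k _; rewrite scalerA.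
  by rewrite -[lshift m k]/(unsplit (inl k)) unsplitK.
by apply: eq_bigr => k _; rewrite -[rshift n k]/(unsplit (inr k)) unsplitK.
Qed.

Lemma lspan_sum I (r : seq I) (c : I -> R[i]) (v : I -> V) :
  (forall i, lspan S (v i)) -> lspan S (\sum_(i <- r) c i *: v i).
Proof.
move=> vS; elim: r => [|i r IH]; first by rewrite big_nil; exact: lspan0.
by rewrite big_cons; exact: lspan_lin.
Qed.

End Span.

(** * Fourier coefficients and the trivial representation *)

Section FourierCoefficients.
Variables (R : realType) (G : cqg R) (h : cqg_A G -> R[i]) (I : irreps h).
Hypothesis haar : haar_state h.
Local Notation C := R[i].

Let sh : state h. Proof. by case: haar. Qed.

(** The summand at p of [fourier_norm1], kept real-valued. *)
Definition fourier_term (x : cqg_A G) (p : I) : R :=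
  complex.Re (\tr (irr_Q p)) * trace_norm (fourier x p *m irr_Q p).

Lemma irr_unitary_mx (p : I) : unitary_mx (irr_rep p).
Proof. exact/unitary_rep_mx/irr_unitary. Qed.

Lemma fourier_term_ge0 x p : 0 <= fourier_term x p.
Proof.
rewrite /fourier_term mulr_ge0 ?trace_norm_ge0 // -lecR -ge0_Re.
  by apply: psdmx_trace_ge0; case: (irr_modular p).
by apply: psdmx_trace_ge0; case: (irr_modular p).
Qed.

Lemma fourierE x (p : I) i k : fourier x p i k = h (star (irr_rep p k i) * x).
Proof. by rewrite !mxE. Qed.

Lemma fourierD x y (p : I) : fourier (x + y) p = fourier x p + fourier y p.
Proof.
by apply/matrixP => i k; rewrite [RHS]mxE !fourierE mulrDr (stateD sh).
Qed.

Lemma fourierZ c x (p : I) : fourier (c *: x) p = c *: fourier x p.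
Proof.
by apply/matrixP => i k; rewrite [RHS]mxE !fourierE -scalerAr (stateZ sh).
Qed.

Lemma fourier0 (p : I) : fourier 0 p = 0.
Proof. by rewrite -(scale0r (0 : cqg_A G)) fourierZ scale0r. Qed.

Lemma fourier_term0 x p : fourier x p = 0 -> fourier_term x p = 0.
Proof.
by move=> x0; rewrite /fourier_term x0 mul0mx -(scale0r 0) trace_normZ normr0 mul0r mulr0.
Qed.

(** Coefficients of inequivalent irreducibles are orthogonal, and [irr_distinct] makes distinct
    indices inequivalent. *)
Lemma fourier_support (S : set I) x p : Pol_on S x -> ~ S p -> fourier x p = 0.
Proof.
move=> Sx nSp; move: x Sx; apply: lspan_ind; first exact: fourier0.
  by move=> c x y x0 y0; rewrite fourierD fourierZ x0 y0 scaler0 addr0.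
move=> _ [q Sq [a [b ->]]]; apply/matrixP => i k; rewrite fourierE mxE.
apply: (irreducible_orthogonal haar);
  try exact: irr_unitary; try exact: irr_irreducible.
by move=> /(@irr_distinct _ _ _ I) qp; apply: nSp; rewrite -qp.
Qed.

Lemma fourier_alg_centered c (p : I) :
  (forall i k, h (irr_rep p i k) = 0) -> fourier c%:A p = 0.
Proof.
move=> p0; apply/matrixP => i k.
by rewrite fourierE mulr_algr (stateZ sh) (state_star sh) p0 rmorph0 mulr0 mxE.
Qed.

Lemma fourier_term_trivial x (p : I) : irr_rep p = 1%:M ->
  fourier_term x p = complex.Re (\tr (irr_Q p)) * trace_norm (irr_Q p) * complex.Re `|h x|.
Proof.
move=> p1; have -> : fourier_term x p =
    complex.Re (\tr (irr_Q p)) * trace_norm (h x *: irr_Q p).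
  rewrite /fourier_term; suff -> : fourier x p = (h x)%:M by rewrite mul_scalar_mx.
  apply/matrixP => i k; rewrite fourierE p1 !mxE eq_sym.
  by case: eqP; rewrite ?star1 ?mul1r // star0 mul0r (state0 sh).
by rewrite trace_normZ mulrCA mulrC.
Qed.

Lemma irr_trivial_unique (p q : I) : irr_rep p = 1%:M -> irr_rep q = 1%:M -> p = q.
Proof.
move=> p1 q1; apply: irr_distinct; rewrite p1 q1.
have := irr_irreducible p; have := irr_irreducible q; rewrite p1 q1.
move=> /irreducible_scalar_dim -> /irreducible_scalar_dim ->.
by exists 1%:M, 1%:M; rewrite mulmx1; split=> //; rewrite /intertwiner mulmx1 mul1mx.
Qed.

(** At most one index carries the trivial representation, so the sum has at most one term; K is the
    factor of |h x| in it, independent of x. *)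
Lemma fourier_trivial_bound : exists2 K : R, 0 <= K &
  forall x, (\esum_(p in [set p : I | irr_rep p = 1%:M]) (fourier_term x p)%:E
             <= (K * complex.Re `|h x|)%:E)%E.
Proof.
have [[p0 p01]|no] := pselect (exists p : I, irr_rep p = 1%:M).
  exists (complex.Re (\tr (irr_Q p0)) * trace_norm (irr_Q p0)).
    have [Qp _ _ _] := irr_modular p0.
    by rewrite mulr_ge0 ?trace_norm_ge0 // -lecR -ge0_Re ?psdmx_trace_ge0.
  move=> x; have -> : [set p : I | irr_rep p = 1%:M] = [set p0].
    by apply/seteqP; split=> [p /= p1|_ ->//]; exact: irr_trivial_unique.
  by rewrite esum_set1 ?lee_fin ?fourier_term_ge0 // fourier_term_trivial.
exists 0 => // x; have -> : [set p : I | irr_rep p = 1%:M] = set0.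
  by apply/seteqP; split=> // p p1; apply: no; exists p.
by rewrite esum_set0 mul0r.
Qed.

(** The splitting is made on generators, which keeps y in the span of E: a coefficient is either
    centered already, with c = 0, or a scalar, with y = 0. *)
Lemma Pol_on_center (E : set I) w : Pol_on E w ->
  exists y c, [/\ Pol_on E y, h y = 0 & w = y + c%:A].
Proof.
move: w; apply: lspan_ind.
- by exists 0, 0; rewrite (state0 sh) scale0r addr0; split=> //; exact: lspan0.
- move=> a x y [x0 [c [Ex hx ->]]] [y0 [d [Ey hy ->]]].
  exists (a *: x0 + y0), (a * c + d); split; first exact: lspan_lin.
    by rewrite (stateD sh) (stateZ sh) hx hy mulr0 addr0.
  by rewrite scalerDr scalerDl scalerA addrACA.
- move=> _ [p Ep [i [k ->]]].
  have [p0|p1] := irreducible_centered haar (irr_unitary p) (irr_irreducible p).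
    exists (irr_rep p i k), 0; rewrite scale0r addr0; split=> //.
    by apply: lspan_gen; exists p => //; exists i, k.
  exists 0, (i == k)%:R; rewrite (state0 sh) add0r p1 mxE; split=> //.
    exact: lspan0.
  by case: eqP; rewrite ?scale1r ?scale0r.
Qed.

End FourierCoefficients.

(** * Fourier coefficients of embedded elements *)

Section Embedding.
Variables (R : realType) (G1 G : cqg R).
Variables (h1 : cqg_A G1 -> R[i]) (h : cqg_A G -> R[i]) (j : cqg_A G1 -> cqg_A G).
Hypothesis haar : haar_state h.
Hypotheses (hj : unital_star_hom j) (hjE : forall x, h (j x) = h1 x).
Variables (I1 : irreps h1) (I : irreps h).
Local Notation C := R[i].

Let sh : state h. Proof. by case: haar. Qed.

Lemma embedded_conj (p : I1) (q : I) :
  equiv_rep (map_mx j (irr_rep p)) (irr_rep q) ->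
  exists2 U : 'M[C]_(irr_dim q, irr_dim p), U *m U ^t* = 1%:M /\ U ^t* *m U = 1%:M
    & irr_rep q = amp_mx G U *m map_mx j (irr_rep p) *m amp_mx G (U ^t*).
Proof.
apply: unitary_intertwiner; last exact: irr_irreducible.
  exact/(unitary_map hj)/irr_unitary_mx.
exact: irr_unitary_mx.
Qed.

(** One and the same unitary U conjugates both the Fourier matrix and the modular matrix, and traces
    and trace norms are invariant under it. *)
Lemma fourier_term_embedding y (p : I1) (q : I) :
  equiv_rep (map_mx j (irr_rep p)) (irr_rep q) ->
  fourier_term (j y) q = fourier_term y p.
Proof.
move=> /embedded_conj[U [UU UU'] qE].
have QE : irr_Q q = U *m irr_Q p *m U ^t*.
  apply: (modular_unique haar (irr_irreducible q).1 (irr_unitary_mx q)).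
    exact: irr_modular.
  exact: (modular_transport sh hj hjE UU UU' qE (irr_modular p)).
have FE : fourier (j y) q = U *m fourier y p *m U ^t*.
  pose f := fun x => h (x * j y).
  have lf : linear_map (f : cqg_A G -> C^o).
    by move=> c x x'; rewrite /f mulrDl -scalerAl (state_linear sh).
  have -> : fourier (j y) q = map_mx f (adj_mx (irr_rep q)).
    by apply/matrixP => i k; rewrite !mxE.
  rewrite qE !adj_mxM !star_amp trmxCK mulmxA (map_functional_amp _ _ _ lf).
  congr (_ *m _ *m _); apply/matrixP => i k; rewrite !mxE /f.
  by rewrite -(star_hom_star hj) -(star_homM hj) hjE.
rewrite /fourier_term QE FE; congr (_ * _).
  by rewrite mxtrace_mulC mulmxA UU' mul1mx.
rewrite -(trace_norm_unitary (fourier y p *m irr_Q p) UU UU'); congr trace_norm.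
by rewrite !mulmxA -[_ *m U ^t* *m U]mulmxA UU' mulmx1.
Qed.

(** Conjugation by U only forms linear combinations of the coefficients of a representation in E,
    and j is linear. *)
Lemma embedded_coef (E : set I1) q i k : irr_image I j E q ->
  exists2 w, Pol_on E w & irr_rep q i k = j w.
Proof.
move=> [p Ep /embedded_conj[U _ qE]].
exists (\sum_b (U ^t*) b k *: \sum_a U i a *: irr_rep p a b).
  apply: lspan_sum => b; apply: lspan_sum => a.
  by apply: lspan_gen; exists p => //; exists a, b.
have jl := star_hom_linear hj.
rewrite qE mulmx_ampE (linear_map_sum jl); apply: eq_bigr => b _.
rewrite amp_mulmxE (linear_mapZ jl) (linear_map_sum jl); congr (_ *: _).
by apply: eq_bigr => a _; rewrite (linear_mapZ jl) mxE.
Qed.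

(** Reindexing along an injective choice of preimages turns the left side into a partial sum of the
    nonnegative series on the right. *)
Lemma embedded_fourier_sum (E : set I1) y :
  (\esum_(q in irr_image I j E) (fourier_term (j y) q)%:E
   <= fourier_norm1 I1 y)%E.
Proof.
have [[q0 [p0 _ _]]|no] := pselect (exists q, irr_image I j E q); last first.
  have -> : irr_image I j E = set0.
    by apply/seteqP; split=> // q qE; apply: no; exists q.
  by rewrite esum_set0; apply: esum_ge0 => p _; rewrite lee_fin fourier_term_ge0.
(* The nonempty case provides the default [p0], which [xget] never returns for want of a preimage
   when q is in the image. *)
pose phi (q : I) := xget p0 [set p : I1 | E p /\ equiv_rep (map_mx j (irr_rep p)) (irr_rep q)].
have phiE q : irr_image I j E q ->
    equiv_rep (map_mx j (irr_rep (phi q))) (irr_rep q).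
  move=> [p Ep pq]; rewrite /phi; case: xgetP => [p' _ []//|/(_ p)[]//].
(* Two classes with the same chosen preimage are equivalent to the same matrix, hence equal. *)
have inj : set_inj (irr_image I j E) phi.
  move=> q q' /set_mem qE /set_mem q'E phiq; apply: irr_distinct.
  apply: equiv_rep_trans (equiv_rep_sym (phiE _ qE)) _.
  by rewrite phiq; exact: phiE.
under eq_esum => q qE do rewrite (fourier_term_embedding y (phiE q qE)).
rewrite -(@esum_image R _ _ _ phi (fun p : I1 => (fourier_term y p)%:E) inj) esum_mkcond.
apply: le_esum => p _; case: ifP => // _.
by rewrite lee_fin fourier_term_ge0.
Qed.

End Embedding.

(** * The Sidon inequality for the union *)

Theorem proposition3p11 (R : realType) (G1 G2 G : cqg R)
    (h1 : cqg_A G1 -> complex R) (h2 : cqg_A G2 -> complex R)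
    (h : cqg_A G -> complex R)
    (haar1 : haar_state h1) (haar2 : haar_state h2) (haar : haar_state h)
    (I1 : irreps h1) (I2 : irreps h2) (I : irreps h)
    (j1 : cqg_A G1 -> cqg_A G) (j2 : cqg_A G2 -> cqg_A G)
    (freeG : dual_free_product h1 h2 h j1 j2)
    (E : set I1) (F : set I2)
    (sidonE : Sidon I1 E) (sidonF : Sidon I2 F) :
  Sidon I (irr_image I j1 E `|` irr_image I j2 F).
Proof.
have [sh1 sh2 sh] : [/\ state h1, state h2 & state h].
  by split; [case: haar1|case: haar2|case: haar].
have [fp _ _] := freeG; have [[hj1 _] [hj2 _] hj1E hj2E fr _ _] := fp.
have fr' := free_pair_sym fr.
have [K1 K10 sE] := sidonE; have [K2 K20 sF] := sidonF.
have [K0 K00 K0P] := fourier_trivial_bound I haar.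
(* [K0] pays for the trivial class; the factors 2 come from [free_component_bound] on either
   side. *)
exists (K0 + (K1 * 2 + K2 * 2)).
  by rewrite ltr_wpDl // addr_gt0 // mulr_gt0.
move=> x Sx; set S := (X in Pol_on X) in Sx.
have [y [z [c [Ey hy Fz hz xE]]]] : exists y z c,
    [/\ Pol_on E y, h1 y = 0, Pol_on F z, h2 z = 0 & x = j1 y + j2 z + c%:A].
  move: x Sx; apply: lspan_ind.
  - exists 0, 0, 0; rewrite (state0 sh1) (state0 sh2) scale0r addr0.
    rewrite (linear_map0 (star_hom_linear hj1)) (linear_map0 (star_hom_linear hj2)).
    by rewrite addr0; split=> //; exact: lspan0.
  - move=> a _ _ [y [z [c [Ey hy Fz hz ->]]]] [y' [z' [c' [Ey' hy' Fz' hz' ->]]]].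
    exists (a *: y + y'), (a *: z + z'), (a * c + c'); split; try exact: lspan_lin.
    + by rewrite (stateD sh1) (stateZ sh1) hy hy' mulr0 addr0.
    + by rewrite (stateD sh2) (stateZ sh2) hz hz' mulr0 addr0.
    + rewrite (star_hom_linear hj1) (star_hom_linear hj2) !scalerDr scalerDl scalerA.
      by rewrite addrACA; congr (_ + _); rewrite addrACA.
  - move=> _ [q [qE|qF] [i [k ->]]].
    + have [w Ew ->] := embedded_coef hj1 i k qE.
      have [y [c [Ey hy ->]]] := Pol_on_center haar1 Ew.
      exists y, 0, c; rewrite (state0 sh2) (linear_map0 (star_hom_linear hj2)) addr0.
      rewrite (linear_mapD (star_hom_linear hj1)) (star_hom_alg hj1).
      by split=> //; exact: lspan0.
    + have [w Fw ->] := embedded_coef hj2 i k qF.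
      have [z [c [Fz hz ->]]] := Pol_on_center haar2 Fw.
      exists 0, z, c; rewrite (state0 sh1) (linear_map0 (star_hom_linear hj1)) add0r.
      rewrite (linear_mapD (star_hom_linear hj2)) (star_hom_alg hj2).
      by split=> //; exact: lspan0.
(* This ties the Fourier term of the trivial class, a multiple of |h x|, to the bound on |c|. *)
have hx : h x = c.
  by rewrite xE !(stateD sh) hj1E hj2E hy hz (state_alg sh) !add0r.
(* The coefficients at q lie in the range of [j1], so [free_mixed] with last factor 1 applies to the
   centered z. *)
have mix1 q : irr_image I j1 E q -> fourier (j2 z) q = 0.
  move=> qE; apply/matrixP => i k; rewrite fourierE mxE.
  have [w _ ->] := embedded_coef hj1 k i qE.
  rewrite -(star_hom_star hj1) -[_ * _]mulr1 -(star_hom1 hj1).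
  exact: (free_mixed sh1 sh hj1 hj1E hj2E fr).
have mix2 q : irr_image I j2 F q -> fourier (j1 y) q = 0.
  move=> qF; apply/matrixP => i k; rewrite fourierE mxE.
  have [w _ ->] := embedded_coef hj2 k i qF.
  rewrite -(star_hom_star hj2) -[_ * _]mulr1 -(star_hom1 hj2).
  exact: (free_mixed sh2 sh hj2 hj2E hj1E fr').
(* Three majorants extended by zero to all of [I], so that their sums can be added; their supports
   may overlap, which an upper bound allows. *)
pose f0 q := if q \in [set q : I | irr_rep q = 1%:M]
             then (fourier_term x q)%:E else 0%E.
pose f1 q := if q \in irr_image I j1 E then (fourier_term (j1 y) q)%:E else 0%E.
pose f2 q := if q \in irr_image I j2 F then (fourier_term (j2 z) q)%:E else 0%E.
have f00 q : (0 <= f0 q)%E by rewrite /f0; case: ifP; rewrite // lee_fin fourier_term_ge0.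
have f10 q : (0 <= f1 q)%E by rewrite /f1; case: ifP; rewrite // lee_fin fourier_term_ge0.
have f20 q : (0 <= f2 q)%E by rewrite /f2; case: ifP; rewrite // lee_fin fourier_term_ge0.
(* The trivial class is charged to [f0]. At any other q the scalar c contributes nothing, so only y
   remains on the image of E and only z on that of F; elsewhere the term is 0 by
   [fourier_support]. *)
have le012 q : ((fourier_term x q)%:E <= f0 q + (f1 q + f2 q))%E.
  have [q0|q1] := irreducible_centered haar (irr_unitary q) (irr_irreducible q); last first.
    have -> : f0 q = (fourier_term x q)%:E by rewrite /f0 mem_set.
    by have uv := adde_ge0 (f10 q) (f20 q); exact: (leeDl _ uv).
  have xq : fourier x q = fourier (j1 y) q + fourier (j2 z) q.
    by rewrite xE !(fourierD haar) (fourier_alg_centered haar _ q0) addr0.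
  have [qE|qnE] := pselect (irr_image I j1 E q).
    apply: le_trans (leeDr _ (f00 q)); apply: le_trans (leeDl _ (f20 q)).
    have -> : f1 q = (fourier_term (j1 y) q)%:E by rewrite /f1 mem_set.
    by rewrite /fourier_term xq (mix1 _ qE) addr0 lexx.
  have [qF|qnF] := pselect (irr_image I j2 F q).
    apply: le_trans (leeDr _ (f00 q)); apply: le_trans (leeDr _ (f10 q)).
    have -> : f2 q = (fourier_term (j2 z) q)%:E by rewrite /f2 mem_set.
    by rewrite /fourier_term xq (mix2 _ qF) add0r lexx.
  have -> : fourier_term x q = 0.
    by apply: fourier_term0; apply: (fourier_support haar Sx) => -[].
  by have uv := adde_ge0 (f10 q) (f20 q); exact: (adde_ge0 (f00 q) uv).
apply: (@le_trans _ _ (\esum_(q in [set: I]) (f0 q + (f1 q + f2 q)))%E).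
  by apply: le_esum => q _; exact: le012.
have f120 q : (0 <= f1 q + f2 q)%E by exact: adde_ge0 (f10 q) (f20 q).
rewrite esumD => [|q _|q _]; [|exact: f00|exact: f120].
rewrite esumD => [|q _|q _]; [|exact: f10|exact: f20].
have b0 : (\esum_(q in [set: I]) f0 q <= K0%:E * gns_norm h x)%E.
  rewrite /f0 -esum_mkcond; apply: le_trans (K0P x) _.
  rewrite EFinM lee_wpmul2l ?lee_fin // hx xE.
  exact: (free_mean_bound sh1 sh hj1 hj1E hj2E fr).
have b1 : (\esum_(q in [set: I]) f1 q <= (K1 * 2)%:E * gns_norm h x)%E.
  rewrite /f1 -esum_mkcond.
  apply: le_trans (embedded_fourier_sum haar hj1 hj1E I E y) _.
  apply: le_trans (sE y Ey) _; rewrite EFinM -muleA lee_wpmul2l ?lee_fin ?(ltW K10) // xE.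
  exact: (free_component_bound sh1 sh hj1 hj1E hj2E fr).
have b2 : (\esum_(q in [set: I]) f2 q <= (K2 * 2)%:E * gns_norm h x)%E.
  rewrite /f2 -esum_mkcond.
  apply: le_trans (embedded_fourier_sum haar hj2 hj2E I F z) _.
  apply: le_trans (sF z Fz) _; rewrite EFinM -muleA lee_wpmul2l ?lee_fin ?(ltW K20) // xE.
  (* Swapping the summands lets the same bound apply with the two factors exchanged. *)
  rewrite (addrC (j1 y)).
  exact: (free_component_bound sh2 sh hj2 hj2E hj1E fr').
apply: (le_trans (leeD b0 (leeD b1 b2))).
(* Nonnegative coefficients let the product distribute in the extended reals even if the GNS norm is
   infinite. *)
have k1 : 0 <= K1 * 2 by rewrite mulr_ge0 // ltW.
have k2 : 0 <= K2 * 2 by rewrite mulr_ge0 // ltW.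
by rewrite !EFinD !ge0_muleDl ?adde_ge0 ?lee_fin.
Qed.
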